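(* Let $\ell,b\in\mathbb R^n$ with $\ell_i<b_i$ for all $i$, let $[\ell,b]=\{x\in\mathbb R^n:\ell\le x\le b\}$, and let $\Phi$ be a real-valued continuously differentiable function with locally Lipschitz gradient on an open neighborhood of $[\ell,b]$. Let $g:\mathbb R^n\to\mathbb R^n$ be given by $g_i(w)=\ell_i+(b_i-\ell_i)\sigma(w_i)$, where $\sigma(t)=1/(1+e^{-t})$. Let $w:[0,+\infty)\to\mathbb R^n$ solve $$\dot w(t)=-\nabla\Phi(x(t)),\qquad x(t)=g(w(t)),\qquad t\ge0,$$ and assume that $x(t)\to x^\star\in[\ell,b]$ as $t\to+\infty$. Then, for every $i$, $$\ell_i<x_i^\star<b_i\ \Longrightarrow\ \nabla_i\Phi(x^\star)=0,$$ $$x_i^\star=\ell_i\ \Longrightarrow\ \nabla_i\Phi(x^\star)\ge0,$$ $$x_i^\star=b_i\ \Longrightarrow\ \nabla_i\Phi(x^\star)\le0.$$ Hence $x^\star$ satisfies the KKT conditions of the problem $\min_{\ell\le x\le b}\Phi(x)$.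
   Context: Vector inequalities are componentwise, and $\nabla_i\Phi$ is the $i$-th component of the Euclidean gradient. The KKT conditions of $\min_{\ell\le x\le b}\Phi(x)$ at $x^\star\in[\ell,b]$ are: there exist $\alpha^\star,\beta^\star\in\mathbb R^n$ with $\alpha^\star\ge0$, $\beta^\star\ge0$, $\nabla\Phi(x^\star)-\alpha^\star+\beta^\star=0$, and $\alpha_i^\star(x_i^\star-\ell_i)=0$, $\beta_i^\star(b_i-x_i^\star)=0$ for all $i$. *)

(* Defs.v *)
From mathcomp Require Import all_boot all_order all_algebra.
From mathcomp Require Import all_classical all_reals all_analysis.

Set Implicit Arguments.
Unset Strict Implicit.
Unset Printing Implicit Defensive.

Import Order.TTheory GRing.Theory Num.Theory.
Import numFieldNormedType.Exports.

Local Open Scope classical_set_scope.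
Local Open Scope ring_scope.

(* The vectors of R^n are the row vectors 'rV[R]_n.  The norm of the library on
   them is the max norm; it is equivalent to the Euclidean norm, so limits,
   differentiability and local Lipschitz continuity are the usual ones. *)

Definition box (R : realType) (n : nat) (l b : 'rV[R]_n) : set 'rV[R]_n :=
  [set x | forall i, l 0 i <= x 0 i <= b 0 i].

Definition gradient (R : realType) (n : nat) (Phi : 'rV[R]_n -> R)
    (x : 'rV[R]_n) : 'rV[R]_n :=
  \row_i 'D_(delta_mx 0 i) Phi x.

(* As U is meant to be open, this depends only on the values of Phi on U. *)
Definition continuously_differentiable_on (R : realType) (n : nat)
    (U : set 'rV[R]_n) (Phi : 'rV[R]_n -> R) : Prop :=
  forall x, U x -> differentiable Phi x /\ {for x, continuous (gradient Phi)}.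

Definition sigmoid (R : realType) (t : R) : R := 1 / (1 + expR (- t)).

Definition box_sigmoid (R : realType) (n : nat) (l b w : 'rV[R]_n) : 'rV[R]_n :=
  \row_i (l 0 i + (b 0 i - l 0 i) * sigmoid (w 0 i)).

(* w' = v on [0, +oo[, the derivative at 0 being one-sided: the values of w at
   negative times are irrelevant. *)
Definition derivative_from0 (R : realType) (n : nat) (w v : R -> 'rV[R]_n) :
    Prop :=
  (h^-1 *: (w h - w 0) @[h --> 0^'+] --> v 0) /\
  (forall t : R, 0 < t -> is_derive t 1 w (v t)).

Definition KKT (R : realType) (n : nat) (Phi : 'rV[R]_n -> R)
    (l b x : 'rV[R]_n) : Prop :=
  box l b x /\
  exists alpha beta : 'rV[R]_n,
    [/\ forall i, 0 <= alpha 0 i,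
        forall i, 0 <= beta 0 i,
        gradient Phi x - alpha + beta = 0,
        forall i, alpha 0 i * (x 0 i - l 0 i) = 0 &
        forall i, beta 0 i * (b 0 i - x 0 i) = 0].

(* Main.v *)
Require Import Defs.
From mathcomp Require Import all_boot all_order all_algebra.
From mathcomp Require Import all_classical all_reals all_analysis.
From mathcomp Require Import ring lra.

Set Implicit Arguments.
Unset Strict Implicit.
Unset Printing Implicit Defensive.

Import Order.TTheory GRing.Theory Num.Theory.
Import numFieldNormedType.Exports.

Local Open Scope classical_set_scope.
Local Open Scope ring_scope.

(** Fix a coordinate i and put c := - gradient Phi xstar 0 i.  As the gradient
    is continuous at xstar, the speed of w_i tends to c.  If c is positive,
    w_i grows at least linearly ([cvgy_of_derive_cvg_gt0]), so that the sigmoid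
    saturates at 1 and x_i tends to b_i; if c is negative, w_i tends to -oo and
    x_i to l_i.  Hence a nonzero i-th partial derivative at xstar forces
    xstar_i onto the bound towards which - gradient Phi points:
    [limit_at_upper_bound] and [limit_at_lower_bound].  The three sign
    conditions are the contrapositives of these two facts, together with
    l_i < b_i, and the positive and negative parts of the gradient are then
    KKT multipliers ([KKT_of_signs]). *)

(** The mean value theorem eventually bounds f from below by a line of slope
    c / 2. *)
Lemma cvgy_of_derive_cvg_gt0 (R : realType) (f df : R -> R) (c : R) :
  0 < c -> (forall t : R, 0 < t -> is_derive t 1 f (df t)) ->
  df t @[t --> +oo] --> c -> f t @[t --> +oo] --> +oo.
Proof.
move=> c0 fdf dfc.
have c2 : c / 2 < c by rewrite ltr_pdivrMr// mulr2n mulrDr mulr1 ltrDl.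
have [M [_ dfM]] := cvgr_gt _ dfc _ c2.
(* T lies beyond M and is positive, so that f is continuous at T itself. *)
pose T := Num.max M 0 + 1.
have T0 : 0 < T by rewrite ltr_pwDr// le_max lexx orbT.
have MT : M < T by rewrite ltr_pwDr// le_max lexx.
apply/cvgryPge => A; near=> t.
have Tt : T < t by near: t; apply: nbhs_pinfty_gt; rewrite num_real.
have [||xi /[!in_itv]/= /andP[Txi _] ft] := MVT (f := f) (df := df) Tt.
- by move=> y /[!in_itv]/= /andP[Ty _]; apply: fdf; exact: lt_trans Ty.
- apply: derivable_within_continuous => y /[!in_itv]/= /andP[Ty _].
  by have [] := fdf y (lt_le_trans T0 Ty).
have line : c / 2 * (t - T) <= f t - f T.
  rewrite ft ler_pM2r ?subr_gt0//; apply/ltW/dfM.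
  exact: lt_trans MT Txi.
rewrite -(subrK (f T) (f t)) -lerBlDr; apply: le_trans line.
rewrite mulrC -ler_pdivrMr ?divr_gt0// lerBrDr.
by near: t; apply: nbhs_pinfty_ge; rewrite num_real.
Unshelve. all: by end_near. Qed.

Lemma cvg_sigmoidy (R : realType) : @sigmoid R t @[t --> +oo] --> (1 : R).
Proof.
rewrite [X in _ --> X](_ : 1 = 1 * (1 + 0)^-1);
  last by rewrite addr0 invr1 mulr1.
apply: cvgM; first exact: cvg_cst.
apply: cvgV; first by rewrite addr0 oner_neq0.
by apply: cvgD; [exact: cvg_cst | exact: cvgr_expR].
Qed.

Lemma sigmoidN (R : realType) (t : R) : sigmoid (- t) = 1 - sigmoid t.
Proof.
rewrite /sigmoid opprK expRN.
have e0 := expR_gt0 t.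
by field; rewrite !gt_eqF ?addr_gt0.
Qed.

Lemma cvg_coord (R : realType) (n : nat) (T : Type) (F : set_system T)
    (FF : Filter F) (f : T -> 'rV[R]_n) (v : 'rV[R]_n) (i : 'I_n) :
  f t @[t --> F] --> v -> f t 0 i @[t --> F] --> v 0 i.
Proof.
move=> fv.
apply: (@continuous_cvg _ _ _ F FF f (fun u : 'rV[R]_n => u 0 i)) fv.
exact: coord_continuous.
Qed.

Section CoordinatewiseLimit.
Variables (R : realType) (n : nat) (l b xstar : 'rV[R]_n).
Variables (Phi : 'rV[R]_n -> R) (w x : R -> 'rV[R]_n).
Hypothesis gradient_cont : {for xstar, continuous (gradient Phi)}.
Hypothesis w_flow :
  forall t : R, 0 < t -> is_derive t 1 w (- gradient Phi (x t)).
Hypothesis x_w : forall t : R, 0 <= t -> x t = box_sigmoid l b (w t).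
Hypothesis x_cvg : x t @[t --> +oo] --> xstar.

Let gradient_cvg i :
  gradient Phi (x t) 0 i @[t --> +oo] --> gradient Phi xstar 0 i.
Proof.
by apply: cvg_coord; exact: continuous_cvg.
Qed.

Let w_coord_flow i (t : R) : 0 < t ->
  is_derive t 1 (fun s => w s 0 i) (- gradient Phi (x t) 0 i).
Proof.
move=> t0; have [dw wE] := w_flow t0.
split; first exact: (derivable_mxP _ _ _).1.
by move: wE; rewrite derive_mx// => /rowP/(_ i); rewrite !mxE.
Qed.

Let coord_limit i (s : R) :
  sigmoid (w t 0 i) @[t --> +oo] --> s ->
  xstar 0 i = l 0 i + (b 0 i - l 0 i) * s.
Proof.
move=> ws.
have xi : x t 0 i @[t --> +oo] --> xstar 0 i by exact: cvg_coord.
apply: (cvg_unique _ xi); first exact: norm_hausdorff.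
apply: (@cvg_trans _
  ((l 0 i + (b 0 i - l 0 i) * sigmoid (w t 0 i)) @[t --> +oo])).
  apply: near_eq_cvg; near=> t.
  by rewrite x_w ?mxE//; near: t; apply: nbhs_pinfty_ge; rewrite num_real.
apply: cvgD; first exact: cvg_cst.
by apply: cvgM; first exact: cvg_cst.
Unshelve. all: by end_near. Qed.

(** The speed of w_i tends to a positive number, so w_i tends to +oo. *)
Lemma limit_at_upper_bound i :
  gradient Phi xstar 0 i < 0 -> xstar 0 i = b 0 i.
Proof.
move=> g0.
rewrite (@coord_limit i 1) ?mulr1 ?subrKC//.
apply: cvg_comp (@cvg_sigmoidy R).
apply: (@cvgy_of_derive_cvg_gt0 _ _ (fun t => - gradient Phi (x t) 0 i)
  (- gradient Phi xstar 0 i)); first by rewrite oppr_gt0.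
  exact: w_coord_flow.
exact: cvgN.
Qed.

(** Here w_i tends to -oo; the symmetry of the sigmoid reduces this to the
    growth of - w_i, whose speed is the i-th partial derivative itself. *)
Lemma limit_at_lower_bound i :
  0 < gradient Phi xstar 0 i -> xstar 0 i = l 0 i.
Proof.
move=> g0.
rewrite (@coord_limit i 0) ?mulr0 ?addr0//.
have -> : (fun t => sigmoid (w t 0 i)) = (fun t => 1 - sigmoid (- w t 0 i)).
  by apply/funext => t; rewrite sigmoidN subKr.
rewrite -[X in _ --> X](subrr 1).
apply: cvgB; first exact: cvg_cst.
apply: (@cvg_comp _ _ _ (fun t => - w t 0 i) (@sigmoid R) _ _ _ _
  (@cvg_sigmoidy R)).
apply: (@cvgy_of_derive_cvg_gt0 _ _ (fun t => gradient Phi (x t) 0 i)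
  _ g0) => // t t0.
rewrite -[gradient Phi (x t) 0 i]opprK.
by apply: is_deriveN; exact: w_coord_flow.
Qed.

End CoordinatewiseLimit.

(** The multipliers are the positive and negative parts of the gradient:
    complementarity holds because each of them vanishes off its own bound. *)
Lemma KKT_of_signs (R : realType) (n : nat) (Phi : 'rV[R]_n -> R)
    (l b x : 'rV[R]_n) :
  box l b x ->
  (forall i, 0 < gradient Phi x 0 i -> x 0 i = l 0 i) ->
  (forall i, gradient Phi x 0 i < 0 -> x 0 i = b 0 i) ->
  KKT Phi l b x.
Proof.
move=> lxb lo up; split=> //.
exists (\row_i Num.max (gradient Phi x 0 i) 0).
exists (\row_i Num.max (- gradient Phi x 0 i) 0).
split=> [i|i||i|i].
- by rewrite mxE le_max lexx orbT.
- by rewrite mxE le_max lexx orbT.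
- apply/rowP => i; rewrite !mxE.
  case: leP => h1; case: leP => h2; lra.
- rewrite mxE; case: leP => [_|/lo ->]; first by rewrite mul0r.
  by rewrite subrr mulr0.
- rewrite mxE; case: leP => [_|]; first by rewrite mul0r.
  by rewrite oppr_gt0 => /up ->; rewrite subrr mulr0.
Qed.

Theorem proposition5p5 (R : realType) (n : nat) (l b : 'rV[R]_n)
    (U : set 'rV[R]_n) (Phi : 'rV[R]_n -> R) (w x : R -> 'rV[R]_n)
    (xstar : 'rV[R]_n) :
  (forall i, l 0 i < b 0 i) ->
  open U ->
  box l b `<=` U ->
  continuously_differentiable_on U Phi ->
  [locally [lipschitz gradient Phi y | y in U]] ->
  derivative_from0 w (fun t => - gradient Phi (x t)) ->
  (forall t : R, 0 <= t -> x t = box_sigmoid l b (w t)) ->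
  box l b xstar ->
  x t @[t --> +oo] --> xstar ->
  (forall i,
    [/\ l 0 i < xstar 0 i < b 0 i -> gradient Phi xstar 0 i = 0,
        xstar 0 i = l 0 i -> 0 <= gradient Phi xstar 0 i &
        xstar 0 i = b 0 i -> gradient Phi xstar 0 i <= 0]) /\
  KKT Phi l b xstar.
Proof.
move=> lb _ boxU Phi_C1 _ [_ w_flow] x_w lxb x_cvg.
have [_ gc] := Phi_C1 _ (boxU _ lxb).
have up i := limit_at_upper_bound gc w_flow x_w x_cvg (i := i).
have lo i := limit_at_lower_bound gc w_flow x_w x_cvg (i := i).
split; last exact: KKT_of_signs.
move=> i; split=> [/andP[lx xb]|xl|xb].
- have [/up e|/lo e|//] := ltgtP (gradient Phi xstar 0 i) 0.
    by rewrite e ltxx in xb.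
  by rewrite e ltxx in lx.
- by rewrite leNgt; apply/negP => /up e; have := lb i; rewrite -xl e ltxx.
- by rewrite leNgt; apply/negP => /lo e; have := lb i; rewrite -xb e ltxx.
Qed.
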